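(* Let $\Sigma=\{1,2,\ldots,n\}$ be a finite ordered alphabet and let $M=[1^{m_1},2^{m_2},\ldots,n^{m_n}]$ be a multiset over $\Sigma$ of cardinality $N=m_1+\cdots+m_n>1$. Then the number of even $N$-words over $M$ is the same as the number of odd $N$-words over $M$.
   Context: Words. $\Sigma=\{1,\ldots,n\}$ is ordered by $1<2<\cdots<n$. $\Sigma^{\star}$ is the set of all finite words over $\Sigma$ and $\Sigma^{+}$ the set of non-empty words. The lexicographic order $\trianglelefteq$ on $\Sigma^\star$ is given by: $w_1\trianglelefteq w_2$ if either $w_1$ is a prefix of $w_2$ (i.e. $w_2=w_1u$ for some $u\in\Sigma^\star$), or $w_1=ras$, $w_2=rbt$ with $r,s,t\in\Sigma^\star$, $a,b\in\Sigma$, $a<b$. Write $w_1\vartriangleleft w_2$ (equivalently $w_2\vartriangleright w_1$) if $w_1\trianglelefteq w_2$ and $w_1\ne w_2$. Lyndon words. A word $w\in\Sigma^+$ is primitive if $w=u^k$ with $u\in\Sigma^+$ implies $k=1$. Two words $w,u$ are conjugate if $w=w_1w_2$ and $u=w_2w_1$ for some words $w_1,w_2$. A Lyndon word is a primitive word that is the smallest in its conjugacy class with respect to the lexicographic order; $L$ denotes the set of Lyndon words. Every word $w\in\Sigma^+$ can be written uniquely as a non-increasing product of Lyndon words $w=l_1l_2\cdots l_h$, $l_i\in L$, $l_1\trianglerighteq l_2\trianglerighteq\cdots\trianglerighteq l_h$ (its Lyndon factorization). Multisets and $N$-words. $M=[1^{m_1},\ldots,n^{m_n}]$ is the multiset with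 $m_i$ occurrences of $i$; its cardinality is $N=m_1+\cdots+m_n$. An $N$-word over $M$ is a word $w=w_1w_2\cdots w_N$ which is a permutation of $M$, i.e. each letter $i$ occurs exactly $m_i$ times in $w$. Lyndon tuple, index, parity. If the Lyndon factorization $w=l_1l_2\cdots l_k$ of an $N$-word $w$ over $M$ has pairwise distinct factors, i.e. $l_1\vartriangleright l_2\vartriangleright\cdots\vartriangleright l_k$, then $tup(w)=(l_k,\ldots,l_2,l_1)$ is the Lyndon tuple of $w$, and the Lyndon index of $w$ is $i_l(w)=N-k$. Words whose Lyndon factorization has a repeated factor have no Lyndon tuple and no Lyndon index. An $N$-word over $M$ that has a Lyndon tuple is called even (resp. odd) if $i_l(w)$ is even (resp. odd); words without a Lyndon tuple are neither even nor odd. *)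

(* Defs.v *)
From HB Require Import structures.
From mathcomp Require Import all_boot all_order.
From mathcomp Require Import boolp.

Set Implicit Arguments.
Unset Strict Implicit.
Unset Printing Implicit Defensive.

Import Order.TTheory.

(* The ordered alphabet {1 < ... < n} is 'I_n: the letter i is the ordinal of
   value i - 1. *)
Notation word n := (seq 'I_n).

Definition lex_le n (u v : word n) : bool :=
  ((u : seqlexi 'I_n) <= (v : seqlexi 'I_n))%O.

Lemma lex_leP n (u v : word n) :
  reflect ((exists t, v = u ++ t) \/
           exists (r s t : word n) (a b : 'I_n),
             [/\ u = r ++ a :: s, v = r ++ b :: t & a < b])
          (lex_le u v).
Proof.
rewrite /lex_le; apply: (iffP idP).
  elim: u v => [|x u IHu] [|y v] //; first by left; exists [::].
    by left; exists (y :: v).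
  rewrite lexi_cons => /andP[xy /implyP yx].
  case: (ltngtP x y) => [xltyy|yltx|/val_inj exy].
  - by right; exists [::], u, v, x, y.
  - by move: xy; rewrite leEord leqNgt yltx.
  - subst y; case: (IHu v (yx (lexx _))) => [[t ->]|].
      by left; exists t.
    move=> [r [s [t [a [b [-> -> ab]]]]]].
    by right; exists (x :: r), s, t, a, b.
case=> [[t ->]|[r [s [t [a [b [-> -> ab]]]]]]].
  by elim: u => [|x u IHu] //=; rewrite lexi_cons lexx.
elim: r => [|x r IHr] /=; last by rewrite lexi_cons lexx.
by rewrite lexi_cons !leEord (ltnW ab) leqNgt ab.
Qed.

Definition primitive n (w : word n) : Prop :=
  w <> [::] /\
  forall (u : word n) (k : nat), u <> [::] -> w = flatten (nseq k u) -> k = 1.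

Definition conjugate n (w u : word n) : Prop :=
  exists w1 w2 : word n, w = w1 ++ w2 /\ u = w2 ++ w1.

Definition lyndon n (w : word n) : Prop :=
  primitive w /\ forall u : word n, conjugate w u -> lex_le w u.

Definition lyndon_factorization n (w : word n) (ls : seq (word n)) : Prop :=
  [/\ w = flatten ls,
      forall l, l \in ls -> lyndon l &
      sorted (fun l l' => lex_le l' l) ls].

Definition lyndon_tuple n (w : word n) (t : seq (word n)) : Prop :=
  exists ls, [/\ lyndon_factorization w ls, uniq ls & t = rev ls].

(* A relation, because some words have no Lyndon index; the subtraction never
   truncates, since the factors are non-empty. *)
Definition lyndon_index n (w : word n) (i : nat) : Prop :=
  exists2 t, lyndon_tuple w t & i = size w - size t.

Definition even_word n (w : word n) : Prop :=
  exists2 i, lyndon_index w i & ~~ odd i.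

Definition odd_word n (w : word n) : Prop :=
  exists2 i, lyndon_index w i & odd i.

(* The multiset M is given by its multiplicity function m. *)
Definition over_multiset n (m : 'I_n -> nat) (w : word n) : Prop :=
  forall i, count_mem i w = m i.

(* Main.v *)
Require Import Defs.
From HB Require Import structures.
From mathcomp Require Import all_boot all_order.
From mathcomp Require Import boolp.

Set Implicit Arguments.
Unset Strict Implicit.
Unset Printing Implicit Defensive.

Import Order.TTheory.

(** Call a tuple of Lyndon words increasing for the lexicographic order a chain.
    Since the Lyndon factorization is unique, a word with pairwise distinct
    Lyndon factors is the same thing as a chain, and its parity is decided by
    the length of the chain.  So it is enough to find an involution on the
    chains of total length at least 2 that preserves the content and changes the
    length by one.  This is [toggle]: it acts on the smallest words of the chain
    only.

    The product [u ++ v] of two Lyndon words [u <l v] is again Lyndon, and lies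
    strictly between [u] and [v] ([below_suffixes_merge]).  Hence the two
    smallest words of a chain can always be replaced by their product, which is
    the smallest word of the new chain.  Conversely a Lyndon word [w] of length
    at least 2 is the product of two Lyndon words [u <l v], where [v] is its
    least proper suffix: the standard factorization
    ([below_suffixes_cut]).  Replacing the smallest word of a chain
    by [u] and [v] gives a chain when [v] is smaller than the second word.

    The rule that makes these two moves inverse to each other: merge the two
    smallest words [s] and [t] when they are the standard factorization of
    [s ++ t], and cut [s] otherwise.
    - After a merge of [s] and [t], with next word [w], the pair of [s ++ t]
      and [w] is not standard, because [t ++ w <l w]: the next move is the cut
      that restores [s] and [t] ([toggle_standard]).
    - When [s] and [t] are not standard, the least proper suffix of [s] is
      smaller than [t], so that the cut yields a chain; its first two words are
      standard by construction and the next move merges them ([toggle_cut]).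
      The word [s] to be cut has at least two letters, since a single letter is
      standard with every larger Lyndon word.

    The only chains without a move are the empty one and a single letter, which
    are excluded by the length.

    All of this is carried out with the characterization of Lyndon words as the
    non-empty words smaller than all their proper suffixes
    ([lyndon_below_suffixes]), which is much easier to handle than minimality in
    a conjugacy class. *)

Local Notation "u <=l v" := ((u : seqlexi _) <= (v : seqlexi _))%O
  (at level 70, no associativity).
Local Notation "u <l v" := ((u : seqlexi _) < (v : seqlexi _))%O
  (at level 70, no associativity).

(** * Lexicographic order and commuting words *)

Section Words.
Context {d : Order.disp_t} {T : orderType d}.
Implicit Types (u v w x y z s t : seq T) (ls : seq (seq T)).

Lemma lexi_cat2l r u v : (r ++ u <=l r ++ v) = (u <=l v).
Proof. by elim: r => //= a r IHr; rewrite lexi_cons lexx. Qed.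

Lemma ltxi_cat2l r u v : (r ++ u <l r ++ v) = (u <l v).
Proof. by elim: r => //= a r IHr; rewrite ltxi_cons lexx. Qed.

Lemma lexi_catr u v : u <=l u ++ v.
Proof. by elim: u => [|a u IHu] //=; rewrite lexi_cons lexx. Qed.

Lemma ltxi_catr u v : v != [::] -> u <l u ++ v.
Proof. by rewrite -{1}[u]cats0 ltxi_cat2l; case: v. Qed.

(** If [v] does not extend [u], then [u <l v] is decided at a position inside
    both words, and what follows them is irrelevant. *)
Lemma ltxi_cat u v x y : ~~ prefix u v -> u <l v -> u ++ x <l v ++ y.
Proof.
elim: u v => [|a u IHu] [|b v] //=; rewrite !ltxi_cons.
by case: (ltgtP a b) => // _; apply: IHu.
Qed.

Lemma eq_catP u v x y : u ++ v = x ++ y ->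
  (exists z, x = u ++ z /\ v = z ++ y) \/
  (exists2 z, z != [::] & u = x ++ z /\ y = z ++ v).
Proof.
elim: u x => [|a u IHu] [|b x] /=.
- by move=> ->; left; exists [::].
- by move=> ->; left; exists (b :: x).
- by move=> <-; right; exists (a :: u).
move=> [-> /IHu[[z [-> ->]]|[z z0 [-> ->]]]]; first by left; exists z.
by right; exists z.
Qed.

Lemma flatten_nseq_cat i j z :
  flatten (nseq i z) ++ flatten (nseq j z) = flatten (nseq (i + j) z).
Proof. by rewrite nseqD flatten_cat. Qed.

(** Euclid's algorithm on the lengths: the shorter word is a prefix of the
    longer one, and commutes with the remainder. *)
Lemma catC_power u v : u ++ v = v ++ u ->
  exists z i j, u = flatten (nseq i z) /\ v = flatten (nseq j z).
Proof.
have [k] := ubnP (size u + size v); elim: k u v => // k IHk u v.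
wlog le_uv : u v / size u <= size v.
  move=> W; case: (leqP (size u) (size v)) => [|/ltnW] le_uv; first exact: W.
  rewrite addnC => hk /esym/(W _ _ le_uv hk)[z [i [j [-> ->]]]].
  by exists z, j, i.
have [->|u0] := eqVneq u [::]; first by exists v, 0, 1; rewrite /= cats0.
move=> hk uv; have [x def_v] : exists x, v = u ++ x.
  case: (eq_catP uv) => [[x [-> _]]|[x x0 [def_u _]]]; first by exists x.
  by move: le_uv; rewrite def_u size_cat -[leqRHS]addn0 leq_add2l leqn0 size_eq0
    (negPf x0).
move: uv; rewrite def_v -catA => /eqP; rewrite eqseq_cat // eqxx => /eqP uv.
have [|z [i [j [-> ->]]]] := IHk u x _ uv.
  rewrite ltnS in hk; apply: leq_trans hk.
  by rewrite def_v size_cat ltn_add2l -[ltnLHS]add0n ltn_add2r lt0n size_eq0.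
by exists z, i, (i + j); rewrite flatten_nseq_cat.
Qed.

(** * Words smaller than their proper suffixes *)

(** For words over a finite ordinal these are the Lyndon words, see
    [lyndon_below_suffixes]. *)
Definition below_suffixes w :=
  w != [::] /\ forall u v, u != [::] -> v != [::] -> w = u ++ v -> w <l v.

(** The point is [u ++ v <l v]; it implies the rest, because a proper suffix of
    [u ++ v] is either a suffix of [v], or a proper suffix of [u] followed by
    [v], whose comparison with [u] is decided before the end of [u]. *)
Lemma below_suffixes_merge u v :
  below_suffixes u -> below_suffixes v -> u <l v ->
  below_suffixes (u ++ v) /\ u ++ v <l v.
Proof.
move=> [u0 Lu] [v0 Lv] uv.
have uv_v : u ++ v <l v.
  have [/prefixP[z def_v]|npre] := boolP (prefix u v); last first.
    by rewrite -[X in _ <l X]cats0; exact: ltxi_cat.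
  have z0 : z != [::].
    by apply: contraTneq uv => z0; rewrite def_v z0 cats0 ltxx.
  by rewrite [X in _ <l X]def_v ltxi_cat2l (Lv u z).
split=> //; split; first by case: (u) u0.
move=> x y x0 y0 def.
case: (eq_catP def) => [[z [def_x def_v]]|[z z0 [def_u ->]]].
  have [z0|z0] := eqVneq z [::].
    by rewrite z0 /= in def_v; rewrite -def_v.
  exact: lt_trans uv_v (Lv _ _ z0 y0 def_v).
apply: ltxi_cat; last exact: (Lu x).
apply: contra x0 => /size_prefix.
by rewrite def_u size_cat -[leqRHS]add0n leq_add2r leqn0 size_eq0.
Qed.

(** * The standard factorization *)

Fixpoint min_suffix w :=
  if w is a :: w' then
    if w' is [::] then w else
    let m := min_suffix w' in if m <=l w then m else w
  else [::].

Lemma min_suffix_cons a b w (m := min_suffix (b :: w)) :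
  min_suffix [:: a, b & w] = if m <=l [:: a, b & w] then m else [:: a, b & w].
Proof. by []. Qed.

Lemma min_suffixP w : w != [::] ->
  [/\ exists u, w = u ++ min_suffix w, min_suffix w != [::] &
      forall u v, v != [::] -> w = u ++ v -> min_suffix w <=l v].
Proof.
elim: w => // a [|b w'] IHw _.
  split=> //; first by exists [::].
  move=> [|c u] v v0 /=; first by move=> <-.
  by case=> _; case: u v v0 => [|? ?] [|? ?].
have [//|[u def_w] m0 minm] := IHw.
rewrite min_suffix_cons; move: (min_suffix _) def_w m0 minm => m.
set w := b :: w' => def_w m0 minm.
case: ifP => [le_m|/negbT]; last rewrite -ltNge => lt_m.
  split=> //; first by exists (a :: u); rewrite def_w.
  move=> [|c x] v v0 /=; first by move=> <-.
  by case=> _ /minm->.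
split=> //; first by exists [::].
move=> [|c x] v v0 /=; first by move=> <-.
by case=> _ /minm le; apply: le_trans (ltW lt_m) (le v0).
Qed.

(** For non-empty [s] and [t]: [s ++ t] has the standard factorization
    [(s, t)]. *)
Definition standard s t := min_suffix (behead (s ++ t)) == t.

Lemma standardP s t : s != [::] -> t != [::] ->
  reflect (forall x y, x != [::] -> y != [::] -> s ++ t = x ++ y -> t <=l y)
          (standard s t).
Proof.
case: s => // a s _ t0; rewrite /standard /=.
have st0 : s ++ t != [::] by case: (s).
apply: (iffP eqP) => [def_t [|b x] y // _ y0 [_ def_st]|le_t].
  by have [_ _ /(_ _ _ y0 def_st)] := min_suffixP st0; rewrite def_t.
have [[u def_st] m0 minm] := min_suffixP st0.
apply: (@le_anti _ (seqlexi T)); apply/andP; split; first exact: (minm s).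
by apply: (le_t (a :: u)) => //; rewrite {1}def_st.
Qed.

Definition cut w :=
  let v := min_suffix (behead w) in [:: take (size w - size v) w; v].

(** The least proper suffix [v] of [w] is below its own suffixes, since they are
    suffixes of [w].  If the prefix [u] were above some proper suffix [y], then
    comparing [w] with its suffix [y ++ v] forces [u = y ++ z], and after
    removal of [y] the suffix [z ++ v] of [w] would be smaller than [v]. *)
Lemma below_suffixes_cut w : below_suffixes w -> 1 < size w ->
  exists u v, [/\ cut w = [:: u; v], w = u ++ v, standard u v &
    [/\ below_suffixes u, below_suffixes v & u <l v]].
Proof.
case: w => [|a w] // [_ Lw]; rewrite ltnS lt0n size_eq0 => w0.
have [[u def_w] v0 minv] := min_suffixP w0.
rewrite /cut /=; set v := min_suffix w in def_w v0 minv *.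
have def_aw : a :: w = (a :: u) ++ v by rewrite def_w.
rewrite -/(size (a :: w)) def_aw size_cat addnK take_size_cat //.
exists (a :: u), v; split=> //; first by rewrite /standard /= -def_w.
have lt_v x y : x != [::] -> y != [::] -> a :: w = x ++ y -> v <=l y.
  by case: x => // b x _ y0 [_ /minv]; apply.
have Luv : a :: u <l v.
  by apply: le_lt_trans (Lw (a :: u) v _ _ _) => //; rewrite def_aw lexi_catr.
split=> //; last first.
  split=> // x y x0 y0 def_v; rewrite lt_neqAle (lt_v (a :: u ++ x)) //=.
    rewrite andbT def_v; apply: contra x0 => /eqP/(congr1 size)/eqP.
    by rewrite size_cat -[eqbRHS]add0n eqn_add2r size_eq0.
  by rewrite -catA -def_v def_w.
split=> // x y x0 y0 def_u; rewrite ltNge; apply/negP => le_yu.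
have lt_w_yv : a :: w <l y ++ v.
  by apply: (Lw x); rewrite ?def_aw ?def_u ?catA //; case: (y) y0.
have lt_yu : y <l a :: u.
  rewrite lt_neqAle le_yu andbT; apply: contra x0 => /eqP/(congr1 size)/eqP.
  by rewrite def_u size_cat -[eqbLHS]add0n eqn_add2r eq_sym size_eq0.
have [/prefixP[z def_z]|npre] := boolP (prefix y (a :: u)); last first.
  by have := lt_trans lt_w_yv (ltxi_cat v v npre lt_yu); rewrite def_aw ltxx.
move: lt_w_yv; rewrite def_aw def_z -catA ltxi_cat2l ltNge => /negP; apply.
apply: (lt_v y) => //; first by case: (z) v0 => //=.
by rewrite def_aw def_z catA.
Qed.

Lemma cut_cat u v : u != [::] -> standard u v -> cut (u ++ v) = [:: u; v].
Proof.
move=> u0 /eqP def_v; rewrite /cut /= def_v size_cat addnK.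
by rewrite take_size_cat.
Qed.

(** A proper suffix of [s ++ t] is either a suffix of [t], above [t] because [t]
    is below its suffixes, or extends a proper suffix of [s].  In particular the
    hypothesis is void for a single letter [s]. *)
Lemma standard_of_suffixes s t : s != [::] -> below_suffixes t ->
  (forall x y, x != [::] -> y != [::] -> s = x ++ y -> t <=l y) -> standard s t.
Proof.
move=> s0 [t0 Lt] le_t; apply/standardP => // x y x0 y0 /eq_catP.
case=> [[z [_ def_t]]|[z z0 [def_s ->]]].
  have [z0|z0] := eqVneq z [::]; first by rewrite def_t z0.
  exact: ltW (Lt _ _ z0 y0 def_t).
exact: le_trans (le_t _ _ x0 z0 def_s) (lexi_catr _ _).
Qed.

(** * The involution on chains *)

(** Used for the strict order (chains) and for the converse of the large order
    (Lyndon factorizations). *)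
Definition lyndon_sorted (e : rel (seq T)) ls :=
  (forall w, w \in ls -> below_suffixes w) /\ sorted e ls.

Lemma lyndon_sorted_cons (e : rel (seq T)) s ls : transitive e ->
  lyndon_sorted e (s :: ls) <->
  [/\ below_suffixes s, lyndon_sorted e ls & forall t, t \in ls -> e s t].
Proof.
move=> e_trans; rewrite /lyndon_sorted /= path_sortedE //.
split=> [[Ls /andP[/allP e_s sort_ls]]|[Ls [Lls sort_ls] /allP e_s]].
  split=> //; first exact/Ls/mem_head.
  by split=> // w ls_w; apply: Ls; rewrite inE ls_w orbT.
split; last exact/andP.
by move=> w; rewrite inE => /predU1P[->|/Lls].
Qed.

Definition lyndon_chain := lyndon_sorted (fun u v => u <l v).

Lemma lyndon_chain_cons s ls : lyndon_chain (s :: ls) <->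
  [/\ below_suffixes s, lyndon_chain ls & forall t, t \in ls -> s <l t].
Proof. exact/lyndon_sorted_cons/(@lt_trans _ (seqlexi T)). Qed.

(** On a singleton the missing second word counts as infinitely large. *)
Definition toggle ls :=
  match ls with
  | [::] => [::]
  | [:: s] => cut s
  | [:: s, t & r] =>
    if standard s t then (s ++ t) :: r else cut s ++ t :: r
  end.

Lemma toggle_cons2 s t r : toggle [:: s, t & r] =
  if standard s t then (s ++ t) :: r else cut s ++ t :: r.
Proof. by []. Qed.

Lemma toggle_standard s t r : lyndon_chain [:: s, t & r] -> standard s t ->
  lyndon_chain ((s ++ t) :: r) /\ toggle ((s ++ t) :: r) = [:: s, t & r].
Proof.
move=> /lyndon_chain_cons[Ls /lyndon_chain_cons[Lt Lr lt_tr] lt_s] st.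
have [Lst lt_st] := below_suffixes_merge Ls Lt (lt_s t (mem_head _ _)).
have [s0 _] := Ls; have [t0 _] := Lt; split.
  by apply/lyndon_chain_cons; split=> // w /lt_tr; apply: lt_trans.
case: r => [|w r] in Lr lt_tr lt_s *; first exact: cut_cat.
rewrite toggle_cons2 cut_cat // ifN //.
have /lyndon_chain_cons[Lw _ _] := Lr; have [w0 _] := Lw.
have [_ lt_tww] := below_suffixes_merge Lt Lw (lt_tr w (mem_head _ _)).
have st0 : s ++ t != [::] by case: (s) s0.
apply/(standardP st0 w0) => /(_ s (t ++ w) s0).
rewrite leNgt lt_tww catA => H.
by have /H/(_ erefl) : t ++ w != [::] by case: (t) t0.
Qed.

Lemma toggle_cut s r : lyndon_chain (s :: r) -> 1 < size s ->
    ~~ (if r is t :: _ then standard s t else false) ->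
  lyndon_chain (cut s ++ r) /\ toggle (cut s ++ r) = s :: r.
Proof.
move=> /lyndon_chain_cons[Ls Lr lt_sr] s1 nst.
have [u [v [-> def_s uv [Lu Lv lt_uv]]]] := below_suffixes_cut Ls s1.
rewrite /= uv -def_s; split=> //.
have [[u0 _] [v0 _] [s0 _]] := And3 Lu Lv Ls.
have lt_vr t : t \in r -> v <l t.
  case: r => // t0 r in Lr lt_sr nst *.
  have /lyndon_chain_cons[Lt0 _ lt_t0r] := Lr.
  suff lt_v : v <l t0.
    by rewrite inE => /predU1P[->|/lt_t0r] //; apply: lt_trans.
  rewrite ltNge; apply: contra nst => le_t0v.
  apply: standard_of_suffixes => // x y x0 y0; rewrite def_s => def_xy.
  exact: le_trans le_t0v (standardP u0 v0 uv _ _ x0 y0 def_xy).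
apply/lyndon_chain_cons; split=> //; first exact/lyndon_chain_cons.
by move=> t; rewrite inE => /predU1P[->|/lt_vr] //; apply: lt_trans.
Qed.

Lemma toggleP ls : lyndon_chain ls -> 1 < size (flatten ls) ->
  [/\ lyndon_chain (toggle ls), flatten (toggle ls) = flatten ls,
      toggle (toggle ls) = ls & odd (size (toggle ls)) = ~~ odd (size ls)].
Proof.
have flat_cut s : below_suffixes s -> 1 < size s ->
    flatten (cut s) = s /\ size (cut s) = 2.
  move=> Ls /(below_suffixes_cut Ls)[u [v [-> def_s _ _]]].
  by rewrite /= cats0.
case: ls => [|s [|t r]] // Lls.
  have -> : flatten [:: s] = s by rewrite /= cats0.
  rewrite [toggle [:: s]]/(cut s) => s1.
  have [Ls _ _] := (lyndon_chain_cons _ _).1 Lls.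
  have := toggle_cut Lls s1 isT; rewrite cats0 => - [Lsp inv_sp].
  by have [-> ->] := flat_cut s Ls s1.
have [Ls /lyndon_chain_cons[Lt _ _] _] := (lyndon_chain_cons _ _).1 Lls.
rewrite toggle_cons2; case: ifP => [st _|/negbT nst _].
  by have [Lst inv_st] := toggle_standard Lls st; rewrite /= catA negbK.
have s1 : 1 < size s.
  rewrite ltnNge; apply: contra nst => le_s1.
  apply: standard_of_suffixes => //; first by case: Ls.
  move=> [|a x] [|b y] // _ _ def_s.
  by rewrite def_s /= size_cat addnS in le_s1.
have [Lsp inv_sp] := toggle_cut Lls s1 nst.
have [flat_s size_s] := flat_cut s Ls s1.
by rewrite flatten_cat flat_s size_cat size_s /= !negbK.
Qed.

(** * Uniqueness of the Lyndon factorization *)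

Lemma prefix_flatten ls x y : x != [::] -> flatten ls = x ++ y ->
  exists z p l, [/\ x = z ++ p, p != [::], l \in ls & prefix p l].
Proof.
elim: ls x => [|l ls IHls] x x0 /=; first by case: x x0.
case/eq_catP=> [[z [def_x def_ls]]|[z z0 [def_l _]]]; last first.
  by exists [::], x, l; rewrite mem_head def_l prefix_prefix.
have [z0|z0] := eqVneq z [::].
  move: x0; rewrite def_x z0 cats0 => l0.
  by exists [::], l, l; rewrite mem_head prefix_refl.
have [z' [p [l' [def_z p0 ls_l' pl']]]] := IHls z z0 def_ls.
exists (l ++ z'), p, l'; rewrite def_x def_z catA inE ls_l' orbT.
by split.
Qed.

Definition nonincreasing := lyndon_sorted (fun u v => v <=l u).

Lemma nonincreasing_cons s ls : nonincreasing (s :: ls) <->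
  [/\ below_suffixes s, nonincreasing ls & forall t, t \in ls -> t <=l s].
Proof. by apply: lyndon_sorted_cons => v u w le_vu /le_trans->. Qed.

(** Uniqueness of the Lyndon factorization.  If the first factor [s'] of one
    factorization were a proper extension of the first factor [s] of another,
    then some proper suffix [p] of [s'] would be a prefix of a factor [l] of the
    latter, and [s' <l p <=l l <=l s <l s']. *)
Lemma nonincreasing_inj ls ls' : nonincreasing ls -> nonincreasing ls' ->
  flatten ls = flatten ls' -> ls = ls'.
Proof.
have longer s r s' r' x : nonincreasing (s :: r) -> nonincreasing (s' :: r') ->
    s' = s ++ x -> flatten r = x ++ flatten r' -> x = [::].
  move=> /nonincreasing_cons[[s0 _] _ le_rs] /nonincreasing_cons[[_ Ls'] _ _].
  move=> def_s' def_r; apply/eqP/negPn/negP => x0.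
  have [z [p [l [def_x p0 r_l /prefixP[y def_l]]]]] := prefix_flatten x0 def_r.
  suff: s' <l s' by rewrite ltxx.
  apply: lt_trans (_ : s <l s'); last by rewrite def_s' ltxi_catr.
  apply: lt_le_trans (le_rs l r_l).
  apply: lt_le_trans (_ : p <=l l); last by rewrite def_l lexi_catr.
  by apply: (Ls' (s ++ z)) => //; rewrite ?def_s' ?def_x ?catA //; case: (s) s0.
elim: ls ls' => [|s r IHr] [|s' r'] //=.
- by move=> _ /nonincreasing_cons[[]]; case: s'.
- by move=> /nonincreasing_cons[[]]; case: s.
move=> Lsr Lsr' eq_f.
have [eq_s eq_r] : s = s' /\ flatten r = flatten r'.
  case: (eq_catP eq_f) => [[x [def_s' def_r]]|[x _ [def_s def_r']]].
    have x0 := longer _ _ _ _ _ Lsr Lsr' def_s' def_r.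
    by rewrite def_s' def_r x0 cats0.
  have x0 := longer _ _ _ _ _ Lsr' Lsr def_s def_r'.
  by rewrite def_s def_r' x0 cats0.
have [_ Lr _] := (nonincreasing_cons _ _).1 Lsr.
have [_ Lr' _] := (nonincreasing_cons _ _).1 Lsr'.
by rewrite eq_s (IHr _ Lr Lr' eq_r).
Qed.

End Words.

(** * Lyndon words and Lyndon tuples *)

(** Let [w = u ++ v] be Lyndon.  Then [w <l v ++ u], the two being distinct
    because commuting words are powers of a common word.  If [v <l w], this
    makes [v] a prefix of [w], say [w = v ++ x] with [x] as long as [u]; so
    [x <l u], and the conjugate [x ++ v] of [w] is smaller than [w].
    Conversely, [w <l v] bounds [w] by the conjugate [v ++ u], and a proper
    power has a proper suffix that is also a prefix. *)
Lemma lyndon_below_suffixes n (w : word n) : lyndon w <-> below_suffixes w.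
Proof.
split=> [[[w0 prim_w] min_w]|[w0 Lw]].
  split=> [|u v u0 v0 def_w]; first exact/eqP.
  have uv_neq : u ++ v != v ++ u.
    apply/eqP => /catC_power[z [i [j [def_u def_v]]]].
    have : i + j = 1.
      apply: (prim_w z); last by rewrite def_w def_u def_v flatten_nseq_cat.
      move=> z0; case/eqP: u0; rewrite def_u z0.
      by elim: (i).
    move: u0 v0; rewrite def_u def_v.
    by case: i j {def_u def_v} => [|i] [|j] //; rewrite addnS.
  have lt_vu : w <l v ++ u.
    rewrite lt_neqAle {1}def_w uv_neq; apply: min_w.
    by exists u, v.
  rewrite ltNge; apply/negP => le_vw.
  have lt_vw : v <l w.
    rewrite lt_neqAle le_vw andbT; apply: contra u0 => /eqP/(congr1 size)/eqP.
    by rewrite def_w size_cat -[eqbLHS]add0n eqn_add2r eq_sym size_eq0.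
  have [/prefixP[x def_x]|npre] := boolP (prefix v w); last first.
    have := lt_trans lt_vu (ltxi_cat u [::] npre lt_vw).
    by rewrite cats0 ltxx.
  have size_x : size x = size u.
    by have := congr1 size def_x; rewrite def_w !size_cat addnC => /addnI.
  have lt_xu : x <l u by move: lt_vu; rewrite def_x ltxi_cat2l.
  have le_xv : w <=l x ++ v by apply: min_w; exists v, x.
  have : x ++ v <l u ++ v.
    apply: ltxi_cat => //; apply: contraL lt_xu => /prefixP[y def_u].
    have /eqP := congr1 size def_u; rewrite size_cat size_x.
    rewrite -[eqbLHS]addn0 eqn_add2l eq_sym size_eq0 => /eqP y0.
    by rewrite def_u y0 cats0 ltxx.
  by rewrite -def_w ltNge le_xv.
split=> [|u [v [z [def_w ->]]]]; last first.
  rewrite /lex_le; have [v0|v0] := eqVneq v [::].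
    by rewrite def_w v0 cats0.
  have [z0|z0] := eqVneq z [::]; first by rewrite def_w z0 cats0.
  exact: le_trans (ltW (Lw v z v0 z0 def_w)) (lexi_catr _ _).
split=> [|u [|[|k]] /eqP u0 def_w] //; first exact/eqP.
  by rewrite def_w in w0.
have uk0 : flatten (nseq k.+1 u) != [::] by case: (u) u0.
have := Lw (flatten (nseq k.+1 u)) u uk0 u0; rewrite ltNge.
have -> : flatten (nseq k.+1 u) ++ u = w.
  by rewrite def_w -[k.+2]addn1 -flatten_nseq_cat /= cats0.
by move=> /(_ erefl); rewrite def_w lexi_catr.
Qed.

Lemma lyndon_tuple_uniq n (w : word n) t t' :
  lyndon_tuple w t -> lyndon_tuple w t' -> t = t'.
Proof.
move=> [ls [[def_w Lls le_ls] _ ->]] [ls' [[def_w' Lls' le_ls'] _ ->]].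
congr rev; apply: nonincreasing_inj; last by rewrite -def_w.
  by split=> // l /Lls/lyndon_below_suffixes.
by split=> // l /Lls'/lyndon_below_suffixes.
Qed.

Lemma lyndon_tupleP n (w : word n) t :
  lyndon_tuple w t <-> w = flatten (rev t) /\ lyndon_chain t.
Proof.
split=> [[ls [[-> Lls le_ls] uniq_ls ->]]|[def_w [Lt lt_t]]].
  rewrite revK; split=> //; split=> [l|].
    by rewrite mem_rev => /Lls/lyndon_below_suffixes.
  rewrite (@lt_sorted_uniq_le _ (seqlexi 'I_n)) rev_uniq uniq_ls.
  by rewrite rev_sorted.
move: lt_t; rewrite (@lt_sorted_uniq_le _ (seqlexi 'I_n)) => /andP[uniq_t le_t].
exists (rev t); rewrite revK rev_uniq; split=> //; split=> //.
  by move=> l; rewrite mem_rev => /Lt/lyndon_below_suffixes.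
by rewrite rev_sorted.
Qed.

Lemma size_lyndon_tuple n (w : word n) t : lyndon_tuple w t -> size t <= size w.
Proof.
move=> /lyndon_tupleP[-> [Lt _]]; rewrite -[size t]size_rev.
have {Lt} : forall l, l \in rev t -> l != [::].
  by move=> l; rewrite mem_rev => /Lt[].
elim: (rev t) => //= l ls IHls l0; rewrite size_cat -add1n leq_add //.
  by rewrite lt0n size_eq0 l0 ?mem_head.
by apply: IHls => x ls_x; rewrite l0 // inE ls_x orbT.
Qed.

Lemma even_wordP n (w : word n) : even_word w <->
  exists2 t, lyndon_tuple w t & ~~ odd (size w - size t).
Proof.
split=> [[i [t wt ->] ?]|[t wt ?]]; first by exists t.
by exists (size w - size t); first exists t.
Qed.

Lemma odd_wordP n (w : word n) : odd_word w <->
  exists2 t, lyndon_tuple w t & odd (size w - size t).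
Proof.
split=> [[i [t wt ->] ?]|[t wt ?]]; first by exists t.
by exists (size w - size t); first exists t.
Qed.

(** * The involution on words *)

Definition lyndon_tuple_of n (w : word n) : seq (word n) :=
  if pselect (exists t, lyndon_tuple w t) is left ex_t then sval (cid ex_t)
  else [::].

Lemma lyndon_tuple_ofE n (w : word n) t :
  lyndon_tuple w t -> lyndon_tuple_of w = t.
Proof.
rewrite /lyndon_tuple_of => wt; case: pselect => [ex_t|[]]; last by exists t.
exact: lyndon_tuple_uniq (svalP (cid ex_t)) wt.
Qed.

Definition flip n (w : word n) : word n :=
  flatten (rev (toggle (lyndon_tuple_of w))).

Lemma perm_flatten_rev (T : eqType) (ls : seq (seq T)) :
  perm_eq (flatten (rev ls)) (flatten ls).
Proof. by apply: perm_flatten; rewrite perm_rev. Qed.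

Lemma flipP n (w : word n) t : lyndon_tuple w t -> 1 < size w ->
  [/\ lyndon_tuple (flip w) (toggle t), perm_eq (flip w) w, flip (flip w) = w &
      odd (size (flip w) - size (toggle t)) = ~~ odd (size w - size t)].
Proof.
move=> wt w1; have [def_w Lt] := (lyndon_tupleP w t).1 wt.
have perm_w : perm_eq w (flatten t) by rewrite def_w perm_flatten_rev.
have [|Lt' flat_t' inv_t odd_t'] := toggleP Lt.
  by rewrite -(perm_size perm_w).
have def_fw : flip w = flatten (rev (toggle t)).
  by rewrite /flip (lyndon_tuple_ofE wt).
have wt' : lyndon_tuple (flip w) (toggle t) by apply/lyndon_tupleP.
have perm_fw : perm_eq (flip w) w.
  by rewrite def_fw (perm_trans (perm_flatten_rev _)) // flat_t' perm_sym.
split=> //; first by rewrite /flip (lyndon_tuple_ofE wt') inv_t -def_w.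
rewrite !oddB ?size_lyndon_tuple // (perm_size perm_fw) odd_t'.
by rewrite addbN.
Qed.

Lemma flip_even n (w : word n) : 1 < size w -> even_word w -> odd_word (flip w).
Proof.
move=> w1 /even_wordP[t wt even_w]; have [wt' _ _ odd_fw] := flipP wt w1.
by apply/odd_wordP; exists (toggle t); rewrite // odd_fw.
Qed.

Lemma flip_odd n (w : word n) : 1 < size w -> odd_word w -> even_word (flip w).
Proof.
move=> w1 /odd_wordP[t wt odd_w]; have [wt' _ _ odd_fw] := flipP wt w1.
by apply/even_wordP; exists (toggle t); rewrite // odd_fw negbK.
Qed.

(** [flip] preserves the multiset and is an involution, hence injective, on the
    words of length at least 2 that have a Lyndon tuple.  The case of even and
    odd words, in both directions, gives the equality of the two cardinals. *)
Lemma leq_card_flip n N (m : 'I_n -> nat) (P Q : word n -> Prop) : 1 < N ->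
    (forall w, P w -> exists t, lyndon_tuple w t) ->
    (forall w, 1 < size w -> P w -> Q (flip w)) ->
  #|[set w : N.-tuple 'I_n | `[< over_multiset m w /\ P w >]]| <=
  #|[set w : N.-tuple 'I_n | `[< over_multiset m w /\ Q w >]]|.
Proof.
move=> N1 P_tuple PQ; set A := finset _; set B := finset _.
pose f (w : N.-tuple 'I_n) : N.-tuple 'I_n := insubd w (flip w).
have fE w : w \in A -> val (f w) = flip w /\ flip (flip w) = w.
  rewrite inE => /asboolP[_ /P_tuple[t wt]].
  have [|_ perm_fw inv_w _] := flipP wt; first by rewrite size_tuple.
  by rewrite val_insubd (perm_size perm_fw) size_tuple eqxx.
have injf : {in A &, injective f}.
  move=> w w' Aw Aw' eq_f; apply: val_inj.
  have [fw inv_w] := fE w Aw; have [fw' inv_w'] := fE w' Aw'.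
  by rewrite -[LHS]inv_w -[RHS]inv_w' -fw -fw' eq_f.
rewrite -(card_in_imset injf).
apply/subset_leq_card/subsetP => _ /imsetP[w Aw ->].
have [fw _] := fE w Aw; move: Aw; rewrite !inE => /asboolP[Mw Pw].
have [t wt] := P_tuple w Pw.
have w1 : 1 < size w by rewrite size_tuple.
have [_ perm_fw _ _] := flipP wt w1.
apply/asboolP; rewrite [X in over_multiset m X]fw [X in Q X]fw.
split; last exact: PQ.
by move=> i; rewrite (permP perm_fw).
Qed.

Theorem proposition3p2 (n N : nat) (m : 'I_n -> nat)
  (hN : N = \sum_(i < n) m i) (N_gt1 : 1 < N) :
  #|[set w : N.-tuple 'I_n | `[< over_multiset m w /\ even_word w >]]| =
  #|[set w : N.-tuple 'I_n | `[< over_multiset m w /\ odd_word w >]]|.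
Proof.
apply/eqP; rewrite eqn_leq; apply/andP; split; apply: leq_card_flip => //.
- by move=> w /even_wordP[t]; exists t.
- exact: flip_even.
- by move=> w /odd_wordP[t]; exists t.
- exact: flip_odd.
Qed.
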